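(* Let $n \ge 1$ be an integer, let $t \ge 0$ be an integer, and let $1 > \epsilon_1 > \dots > \epsilon_n > 0$ be real numbers. Let $M_n$ be the set of all $n$-tuples $(m_1, \dots, m_n)$ of nonnegative integers satisfying $m_1 + \dots + m_n = n$ and $m_1 + \dots + m_r > r$ for every $r$ with $1 \le r < n$. Then $$H_n(t) = \frac{1}{(2\pi i)^n} \int_{|z_1| = \epsilon_1} \cdots \int_{|z_n| = \epsilon_n} (z_1 \cdots z_n)^{-t-1} \sum_{(m_1,\dots,m_n) \in M_n} \binom{n}{m_1, \dots, m_n} \prod_{k=1}^n \left( \frac{z_k^{t+n-1}}{\prod_{j \neq k} (z_k - z_j)} \right)^{m_k} dz_n \cdots dz_1 ,$$ where in the inner product $j$ ranges over $\{1,\dots,n\}\setminus\{k\}$.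
   Context: The $n$-th Birkhoff polytope $\mathcal{B}_n \subset \mathbb{R}^{n^2}$ is the set of all real $n \times n$ matrices $(x_{jk})$ with $x_{jk} \ge 0$ for all $j,k$ and with every row sum and every column sum equal to $1$. Its Ehrhart counting function is $H_n(t) = \#\left(t\mathcal{B}_n \cap \mathbb{Z}^{n^2}\right)$, i.e. the number of $n \times n$ matrices with nonnegative integer entries in which every row and every column sums to $t$. The symbol $\binom{n}{m_1,\dots,m_n} = \frac{n!}{m_1! \cdots m_n!}$ is the multinomial coefficient. Each integral $\int_{|z_k| = \epsilon_k}$ is a complex contour integral over the circle of radius $\epsilon_k$ centered at $0$, traversed once counterclockwise. *)

(* Defs.v *)
From mathcomp Require Import all_boot all_order all_algebra.
From mathcomp Require Import finmap complex.
From mathcomp Require Import all_classical all_reals all_analysis.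

Set Implicit Arguments.
Unset Strict Implicit.
Unset Printing Implicit Defensive.

Import Order.TTheory GRing.Theory Num.Theory.
Import numFieldNormedType.Exports.

Local Open Scope classical_set_scope.
Local Open Scope ring_scope.
Local Open Scope complex_scope.

Definition birkhoff (R : realType) (n : nat) : set 'M[R]_n :=
  [set X | [/\ forall j k, 0 <= X j k,
               forall j, \sum_k X j k = 1 &
               forall k, \sum_j X j k = 1]].

Arguments birkhoff : clear implicits.

Definition birkhoff_lattice (R : realType) (n t : nat) : set 'M[R]_n :=
  [set t%:R *: X | X in birkhoff R n] `&`
  [set X | forall j k, X j k \in Num.int].

Arguments birkhoff_lattice : clear implicits.

Lemma finite_birkhoff_lattice (R : realType) (n t : nat) :
  finite_set (birkhoff_lattice R n t).
Proof.
pose f (A : 'M['I_t.+1]_n) : 'M[R]_n := map_mx (fun i : 'I_t.+1 => i%:R) A.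
apply: (@sub_finite_set _ _ (f @` setT)); last exact/finite_image/finite_finset.
move=> _ [[X [X0 Xr _] <-] Xint].
have Xle j k : X j k <= 1.
  by rewrite -(Xr j) (bigD1 k)//= lerDl sumr_ge0.
exists (\matrix_(j, k) inord (Num.truncn (t%:R * X j k))) => //.
apply/matrixP => j k; rewrite !mxE.
have tX0 : 0 <= t%:R * X j k by rewrite mulr_ge0.
have tXnat : t%:R * X j k \in Num.nat.
  by rewrite natrEint tX0 andbT; have := Xint j k; rewrite mxE.
by rewrite inordK ?truncnK // ltnS -(ler_nat R) truncnK // ler_piMr.
Qed.

(* [fset_set] is only meaningful on finite sets: see
   [finite_birkhoff_lattice]. *)
Definition ehrhart (R : realType) (n t : nat) : nat :=
  #|` fset_set (birkhoff_lattice R n t)|%fset.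

Definition complex_int (R : realType) (D : set R) (f : R -> R[i]) : R[i] :=
  Rintegral lebesgue_measure D (fun x => complex.Re (f x)) +i*
  Rintegral lebesgue_measure D (fun x => complex.Im (f x)).

Definition circle (R : realType) (r x : R) : R[i] :=
  (r * cos x) +i* (r * sin x).

(* With z = r e^{ix} one has dz = i z dx. *)
Definition circle_int (R : realType) (r : R) (f : R[i] -> R[i]) : R[i] :=
  complex_int `[0, 2 * pi]
    (fun x => f (circle r x) * ('i%C * circle r x)).

Definition fcons (T : Type) (n : nat) (z : T) (w : 'I_n -> T) (i : 'I_n.+1) : T :=
  if unlift ord0 i is Some j then w j else z.

(* The outermost integral is over the first variable. *)
Fixpoint iter_circle_int (R : realType) (n : nat) :
    ('I_n -> R) -> (('I_n -> R[i]) -> R[i]) -> R[i] :=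
  match n with
  | 0 => fun eps F => F (fun=> 0)
  | p.+1 => fun eps F =>
      circle_int (eps ord0) (fun z =>
        iter_circle_int (fun i => eps (lift ord0 i)) (fun w => F (fcons z w)))
  end.

(* Entries of a tuple of naturals with sum n are at most n, so bounding the
   entry type by 'I_n.+1 loses nothing. Indices start at 0: the entries with
   index i < r are the first r ones. *)
Definition Mset (n : nat) : {set {ffun 'I_n -> 'I_n.+1}} :=
  [set m : {ffun 'I_n -> 'I_n.+1} | (\sum_i m i == n)%N &&
    [forall r : 'I_n, (0 < r)%N ==> (r < \sum_(i < n | (i < r)%N) m i)%N]]%SET.

Definition multinomial (F : fieldType) (n : nat) (m : 'I_n -> nat) : F :=
  n`!%:R / \prod_i (m i)`!%:R.

(* Main.v *)
(** On the torus [|z_k| = eps_k] the integrand is a uniform limit of Laurent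
    polynomials, because [1 / (z_k - z_j)] is there a geometric series in
    [z_j / z_k] for [k < j]; the iterated integral extracts the coefficient of
    [(z_1 ... z_n)^-1]. Summed over all tuples [m] of total [n], the integrand is
    [(z_1 ... z_n)^(-t-1) h_t(z)^n] by the multinomial theorem, where [h_t] is
    the complete homogeneous symmetric polynomial, and the coefficient extracted
    counts the integer points of [t B_n]. If [m_1 + ... + m_r <= r] for some
    [0 < r < n], every Laurent monomial in the expansion of the term of [m] has
    degree less than [-r] in [z_1, ..., z_r], so that this term contributes 0. *)

Require Import Defs.
From mathcomp Require Import all_boot all_order all_algebra.
From mathcomp Require Import finmap complex.
From mathcomp Require Import all_classical all_reals all_analysis.
From mathcomp Require Import ring zify.

Set Implicit Arguments.
Unset Strict Implicit.
Unset Printing Implicit Defensive.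

Import Order.TTheory GRing.Theory Num.Theory.
Import numFieldNormedType.Exports.

Local Open Scope ring_scope.
Local Open Scope complex_scope.

(** * Trigonometric integrals over a full turn *)

Section Circle.
Variable R : realType.
Implicit Types (r x y : R) (k : int).

Lemma circleE r x : circle r x = r%:C * circle 1 x.
Proof. by apply/eqP; rewrite eq_complex /= !mul0r subr0 addr0 !mul1r !eqxx. Qed.

Lemma circleD x y : circle 1 (x + y) = circle 1 x * circle 1 y.
Proof.
apply/eqP; rewrite eq_complex /= cosD sinD !mul1r eqxx /=.
by rewrite addrC eqxx.
Qed.

Lemma circle0 : circle 1 (0 : R) = 1.
Proof. by rewrite /circle cos0 sin0 mulr1 mulr0. Qed.

(** Negative powers reduce to natural ones because [circle 1 y] and [circle 1 (- y)] are inverse to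
    each other, so that no value of [circle 1] vanishes. *)
Lemma circleX k x : circle 1 x ^ k = circle 1 (k%:~R * x).
Proof.
have pos n : circle 1 x ^+ n = circle 1 (n%:R * x).
  elim: n => [|n IHn]; first by rewrite mul0r circle0 expr0.
  by rewrite exprS IHn -circleD -natr1 mulrDl mul1r addrC.
case: k => n; first exact: pos.
rewrite NegzE -exprnN pos mulrNz mulNr.
apply: (mulIf (_ : circle 1 (n.+1%:R * x) != 0)).
  apply/eqP => h0; have := circleD (n.+1%:R * x) (- (n.+1%:R * x)).
  by rewrite subrr circle0 h0 mul0r => /eqP; rewrite oner_eq0.
rewrite -circleD addNr circle0 mulVf//; apply/eqP => h0.
have := circleD (n.+1%:R * x) (- (n.+1%:R * x)).
by rewrite subrr circle0 h0 mul0r => /eqP; rewrite oner_eq0.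
Qed.

Lemma norm_circle r x : 0 <= r -> `|circle r x| = r%:C.
Proof.
move=> r0; rewrite normc_def /= !exprMn -mulrDr cos2Dsin2 mulr1.
by rewrite sqrtr_sqr ger0_norm.
Qed.

Lemma circle2pi k : circle 1 (k%:~R * (2 * pi)) = 1 :> R[i].
Proof.
rewrite -circleX /circle mulr_natl cos2pi sin2pi mulr1 mulr0.
exact: exp1rz.
Qed.

Let mu := @lebesgue_measure R.

Lemma integrable_continuous_segment (f : R -> R) (a b : R) :
  continuous f -> mu.-integrable `[a, b]%classic (EFin \o f).
Proof.
move=> cf; apply: continuous_compact_integrable; first exact: segment_compact.
exact: continuous_subspaceT.
Qed.

Lemma continuous_FTC2_segment (f F : R -> R) (a b : R) : a < b ->
  continuous f -> (forall x, is_derive x 1 F (f x)) ->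
  Rintegral mu `[a, b] f = F b - F a.
Proof.
move=> ab cf dF.
have cF : continuous F.
  by move=> x; apply/differentiable_continuous/derivable1_diffP; have [] := dF x.
rewrite /Rintegral (@continuous_FTC2 _ f F)//.
- exact: continuous_subspaceT.
- split.
  + by move=> x _; have [] := dF x.
  + exact/cvg_at_right_filter/cF.
  + exact/cvg_at_left_filter/cF.
- by move=> x _; rewrite derive1E; have [_ ->] := dF x.
Qed.

Lemma continuous_cosM k : continuous (fun x => cos (k%:~R * x)).
Proof.
move=> x; apply: (@continuous_comp _ _ _ (fun x => k%:~R * x) cos).
  by apply: cvgM; [exact: cvg_cst|exact: cvg_id].
exact: continuous_cos.
Qed.

Lemma continuous_sinM k : continuous (fun x => sin (k%:~R * x)).
Proof.
move=> x; apply: (@continuous_comp _ _ _ (fun x => k%:~R * x) sin).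
  by apply: cvgM; [exact: cvg_cst|exact: cvg_id].
exact: continuous_sin.
Qed.

Lemma pi2_gt0 : 0 < 2 * pi :> R.
Proof. by rewrite mulr_gt0// pi_gt0. Qed.

(** For [k != 0] the antiderivative [sin (k x) / k] takes the same value at both ends of a full
    turn. *)
Lemma Rintegral_cosM k :
  Rintegral mu `[0, 2 * pi] (fun x => cos (k%:~R * x)) = (k == 0)%:R * (2 * pi).
Proof.
case: eqVneq => [->|k0].
  under eq_Rintegral do rewrite mul0r cos0.
  rewrite Rintegral_cst//= lebesgue_measure_itv/= lte_fin pi2_gt0/=.
  by rewrite ?oppr0 ?addr0 ?sube0.
have dF x : is_derive x 1 (fun x => k%:~R^-1 * sin (k%:~R * x)) (cos (k%:~R * x)).
  apply: is_derive_eq.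
  rewrite /GRing.scale/= ?mulr0 ?addr0 ?add0r ?mulr1.
  by rewrite mulrCA mulVf ?intr_eq0// mulr1.
rewrite (continuous_FTC2_segment _ _ dF)//; last 2 first.
- exact: pi2_gt0.
- exact: continuous_cosM.
have := circle2pi k; rewrite /circle => -[_ +]; rewrite mul1r => ->.
by rewrite !mulr0 sin0 mulr0 mul0r subrr.
Qed.

Lemma Rintegral_sinM k :
  Rintegral mu `[0, 2 * pi] (fun x => sin (k%:~R * x)) = 0.
Proof.
case: (eqVneq k 0) => [->|k0].
  under eq_Rintegral do rewrite mul0r sin0.
  by rewrite Rintegral_cst// mul0r.
have dF x : is_derive x 1 (fun x => - k%:~R^-1 * cos (k%:~R * x)) (sin (k%:~R * x)).
  apply: is_derive_eq.
  rewrite /GRing.scale/= ?mulr0 ?addr0 ?add0r ?mulr1.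
  by rewrite mulNr mulNr mulrN opprK mulrCA mulVf ?intr_eq0// mulr1.
rewrite (continuous_FTC2_segment _ _ dF)//; last 2 first.
- exact: pi2_gt0.
- exact: continuous_sinM.
have := circle2pi k; rewrite /circle => -[+ _]; rewrite mul1r => ->.
by rewrite mulr0 cos0 subrr.
Qed.

End Circle.

(** * Circle integrals of uniform limits of Laurent polynomials *)

Section CircleIntegral.
Variable R : realType.
Let mu := @lebesgue_measure R.
Implicit Types (f g : R[i] -> R[i]) (r d : R) (s : seq (R[i] * int)).

Lemma continuous_uniform_approx (h : R -> R) :
  (forall d, 0 < d -> exists2 p : R -> R, continuous p &
     forall x, `|h x - p x| <= d) -> continuous h.
Proof.
move=> happ x; apply/cvgrPdist_le => e e0.
have e3 : 0 < e / 3 by rewrite divr_gt0.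
have [p cp hp] := happ _ e3.
have /cvgrPdist_le/(_ _ e3) := cp x.
apply: filterS => y pxy.
have -> : h x - h y = (h x - p x) + (p x - p y) - (h y - p y).
  by ring.
rewrite (le_trans (ler_normB _ _))// (_ : e = e / 3 + e / 3 + e / 3).
  by rewrite lerD ?hp// (le_trans (ler_normD _ _))// lerD ?hp.
by field.
Qed.

Lemma Rintegral_dist (h p : R -> R) d : continuous h -> continuous p ->
  (forall x, `|h x - p x| <= d) ->
  `|Rintegral mu `[0, 2 * pi] h - Rintegral mu `[0, 2 * pi] p| <= 2 * pi * d.
Proof.
move=> ch cp hp.
have chp : continuous (fun x => h x - p x).
  by move=> x; apply: cvgB; [exact: ch|exact: cp].
rewrite -RintegralB//; try exact: integrable_continuous_segment.
apply: (le_trans (le_normr_Rintegral _ _)) => //.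
  exact (@integrable_continuous_segment R (fun x => h x - p x) 0 (2 * pi) chp).
have -> : 2 * pi * d = Rintegral mu `[0, 2 * pi] (fun=> d).
  rewrite Rintegral_cst//= /mu lebesgue_measure_itv/= lte_fin pi2_gt0/=.
  by rewrite ?oppr0 ?addr0 mulrC.
apply: le_Rintegral => //; apply: integrable_continuous_segment.
  by move=> x; apply: cvg_norm; exact: chp.
by move=> x; exact: cvg_cst.
Qed.

(* The pullback of the form [f z dz] along [x |-> r e^{ix}]. *)
Definition circle_form r f (x : R) := f (circle r x) * ('i%C * circle r x).

(** Continuity is carried along with the value because additivity of [Rintegral] requires integrable
    summands. *)
Definition continuous_circle_int r f (v : R[i]) :=
  [/\ continuous (fun x => complex.Re (circle_form r f x)),
      continuous (fun x => complex.Im (circle_form r f x)) &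
      circle_int r f = v].

Lemma continuous_circle_intD r f g u v :
  continuous_circle_int r f u -> continuous_circle_int r g v ->
  continuous_circle_int r (fun z => f z + g z) (u + v).
Proof.
move=> [cRf cIf <-] [cRg cIg <-].
have E x : circle_form r (fun z => f z + g z) x =
    circle_form r f x + circle_form r g x by rewrite /circle_form mulrDl.
have ER : (fun x => complex.Re (circle_form r (fun z => f z + g z) x)) =
    (fun x => complex.Re (circle_form r f x) + complex.Re (circle_form r g x)).
  by apply/funext => x; rewrite E raddfD.
have EI : (fun x => complex.Im (circle_form r (fun z => f z + g z) x)) =
    (fun x => complex.Im (circle_form r f x) + complex.Im (circle_form r g x)).
  by apply/funext => x; rewrite E raddfD.
split.
- by rewrite ER => x; apply: cvgD; [exact: cRf|exact: cRg].
- by rewrite EI => x; apply: cvgD; [exact: cIf|exact: cIg].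
- rewrite /circle_int /complex_int -!/(circle_form _ _ _) ER EI.
  by rewrite !RintegralD//; exact: integrable_continuous_segment.
Qed.

(** The pullback of [z ^ k dz] to the angle is a constant times [e^{i(k+1)x}], whose mean over a
    full turn vanishes unless [k = -1]. *)
Lemma continuous_circle_int_monomial r (a : R[i]) (k : int) : 0 < r ->
  continuous_circle_int r (fun z => a * z ^ k)
    ((2 * pi)%:C * 'i%C * ((k == -1)%:R * a)).
Proof.
move=> r0; pose b := a * 'i%C * r%:C ^ (k + 1).
have rC0 : r%:C != 0 by rewrite eq_complex /= eqxx andbT gt_eqF.
have E : circle_form r (fun z => a * z ^ k) =
    (fun x => b * circle 1 ((k + 1)%:~R * x)).
  apply/funext => x.
  have c0 : circle r x != 0 by rewrite -normr_eq0 norm_circle// ltW.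
  rewrite /circle_form mulrACA -[X in _ * (_ * X)]expr1z -expfzDr//.
  by rewrite {1}circleE expfzMl circleX mulrA.
have ER : (fun x => complex.Re (circle_form r (fun z => a * z ^ k) x)) =
    (fun x => complex.Re b * cos ((k + 1)%:~R * x) -
              complex.Im b * sin ((k + 1)%:~R * x)).
  by apply/funext => x; rewrite E /circle; case: (b) => u v /=; rewrite !mul1r.
have EI : (fun x => complex.Im (circle_form r (fun z => a * z ^ k) x)) =
    (fun x => complex.Re b * sin ((k + 1)%:~R * x) +
              complex.Im b * cos ((k + 1)%:~R * x)).
  by apply/funext => x; rewrite E /circle; case: (b) => u v /=; rewrite !mul1r.
have cc c : continuous (fun x : R => c * cos ((k + 1)%:~R * x)).
  by move=> x; apply: cvgM; [exact: cvg_cst|exact: continuous_cosM].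
have cs c : continuous (fun x : R => c * sin ((k + 1)%:~R * x)).
  by move=> x; apply: cvgM; [exact: cvg_cst|exact: continuous_sinM].
split.
- by rewrite ER => x; apply: cvgB; [exact: cc|exact: cs].
- by rewrite EI => x; apply: cvgD; [exact: cs|exact: cc].
- rewrite /circle_int /complex_int -!/(circle_form _ _ _) ER EI.
  rewrite RintegralB//; try exact: integrable_continuous_segment.
  rewrite RintegralD//; try exact: integrable_continuous_segment.
  rewrite !RintegralZl//; try exact/integrable_continuous_segment/continuous_cosM;
    try exact/integrable_continuous_segment/continuous_sinM.
  rewrite !Rintegral_cosM !Rintegral_sinM !mulr0 subr0 add0r addr_eq0.
  case: eqP => [k1|_]; last by rewrite !mul0r !mulr0.
  rewrite /b k1 addNr expr0z mulr1 !mul1r.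
  case: (a) => u v; apply/eqP; rewrite eq_complex /=.
  by apply/andP; split; apply/eqP; ring.
Qed.

(** A Laurent polynomial is encoded as a list of coefficients with exponents. Exponents may repeat,
    so that concatenation is addition. *)
Definition laurent1 s (z : R[i]) := \sum_(p <- s) p.1 * z ^ p.2.
Definition residue1 s := \sum_(p <- s | p.2 == -1) p.1.

Lemma continuous_circle_int_laurent1 r s : 0 < r ->
  continuous_circle_int r (laurent1 s) ((2 * pi)%:C * 'i%C * residue1 s).
Proof.
move=> r0; elim: s => [|[a k] s IHs].
  have := continuous_circle_int_monomial 0 0 r0.
  rewrite mulr0 /residue1 big_nil.
  by congr continuous_circle_int; apply/funext => z; rewrite mul0r /laurent1 big_nil.
have := continuous_circle_intD (continuous_circle_int_monomial a k r0) IHs.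
congr continuous_circle_int.
  by apply/funext => z; rewrite /laurent1 big_cons.
rewrite -mulrDr /residue1 big_cons /=.
by case: eqP => _; rewrite ?mul1r ?mul0r ?add0r.
Qed.

Lemma norm_real_complex (x : R) : `|x%:C| = `|x|%:C.
Proof.
have [x0|x0] := leP 0 x; first by rewrite !ger0_norm ?ler0c.
by rewrite -normrN -rmorphN -[in RHS]normrN !ger0_norm ?ler0c ?oppr_ge0 ?ltW.
Qed.

Lemma norm_i : `|'i%C : R[i]| = 1.
Proof.
by apply/eqP; rewrite -(@pexpr_eq1 _ _ 2)// -normrX sqr_i normrN1.
Qed.

Lemma norm_Re_le (z : R[i]) : `|complex.Re z|%:C <= `|z|.
Proof.
rewrite normc_def lecR -sqrtr_sqr ler_sqrt ?addr_ge0 ?sqr_ge0//.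
by rewrite lerDl sqr_ge0.
Qed.

Lemma norm_Im_le (z : R[i]) : `|complex.Im z|%:C <= `|z|.
Proof.
rewrite normc_def lecR -sqrtr_sqr ler_sqrt ?addr_ge0 ?sqr_ge0//.
by rewrite lerDr sqr_ge0.
Qed.

Lemma norm_le_ReIm (z : R[i]) : `|z| <= (`|complex.Re z| + `|complex.Im z|)%:C.
Proof.
rewrite {1}[z]complexE (le_trans (ler_normD _ _))// normrM.
by rewrite norm_i mul1r !norm_real_complex -rmorphD.
Qed.

(* Approximability at every precision makes [f] continuous on the circle, hence
   integrable; the bound then holds for any one approximation. *)
Lemma circle_int_approx r f : 0 < r <= 1 ->
  (forall d, 0 < d -> exists s, forall z, `|z| = r%:C ->
     `|f z - laurent1 s z| <= d%:C) ->
  forall d s, (forall z, `|z| = r%:C -> `|f z - laurent1 s z| <= d%:C) ->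
  `|circle_int r f - (2 * pi)%:C * 'i%C * residue1 s| <= (4 * pi * d)%:C.
Proof.
move=> /andP[r0 r1] fapp.
(* The factor ['i%C * circle r x] has modulus [r <= 1], so passing from functions to forms does not
   increase the error. *)
have close d s : (forall z, `|z| = r%:C -> `|f z - laurent1 s z| <= d%:C) ->
    forall x, `|circle_form r f x - circle_form r (laurent1 s) x| <= d%:C.
  move=> fs x; rewrite /circle_form -mulrBl normrM normrM.
  rewrite norm_circle ?(ltW r0)// norm_i mul1r.
  rewrite -[leRHS]mulr1 ler_pM ?normr_ge0 ?fs ?norm_circle ?(ltW r0)//.
  by rewrite ler0c ltW.
  by rewrite lecR.
have cR : continuous (fun x => complex.Re (circle_form r f x)).
  apply: continuous_uniform_approx => d d0; have [s /close fs] := fapp _ d0.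
  have [cRs _ _] := continuous_circle_int_laurent1 s r0.
  exists (fun x => complex.Re (circle_form r (laurent1 s) x)) => // x.
  by rewrite -lecR -raddfB (le_trans (norm_Re_le _)).
have cI : continuous (fun x => complex.Im (circle_form r f x)).
  apply: continuous_uniform_approx => d d0; have [s /close fs] := fapp _ d0.
  have [_ cIs _] := continuous_circle_int_laurent1 s r0.
  exists (fun x => complex.Im (circle_form r (laurent1 s) x)) => // x.
  by rewrite -lecR -raddfB (le_trans (norm_Im_le _)).
move=> d s /close fs.
have [cRs cIs <-] := continuous_circle_int_laurent1 s r0.
rewrite (le_trans (norm_le_ReIm _))// lecR !raddfB /=.
(* The real and the imaginary part each contribute an error of at most [2 * pi * d]. *)
rewrite (_ : 4 * pi * d = 2 * pi * d + 2 * pi * d); last by ring.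
apply: lerD; apply: Rintegral_dist => // x; rewrite -lecR -raddfB.
  exact: le_trans (norm_Re_le _) (fs x).
exact: le_trans (norm_Im_le _) (fs x).
Qed.

End CircleIntegral.

(** * Iterated circle integrals and residues in several variables *)

Section IteratedIntegral.
Variable R : realType.
Implicit Types (n : nat) (d : R).

Definition laurent n (s : seq (R[i] * {ffun 'I_n -> int})) (z : 'I_n -> R[i]) :=
  \sum_(p <- s) p.1 * \prod_k z k ^ p.2 k.

Definition residue n (s : seq (R[i] * {ffun 'I_n -> int})) :=
  \sum_(p <- s | p.2 == [ffun=> -1]) p.1.

Definition on_torus n (eps : 'I_n -> R) (z : 'I_n -> R[i]) :=
  forall k, `|z k| = (eps k)%:C.

Definition laurent_approx n (eps : 'I_n -> R) d
    (s : seq (R[i] * {ffun 'I_n -> int})) (F : ('I_n -> R[i]) -> R[i]) :=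
  forall z, on_torus eps z -> `|F z - laurent s z| <= d%:C.

Lemma fcons0 T n (z : T) (w : 'I_n -> T) : fcons z w ord0 = z.
Proof. by rewrite /fcons unlift_none. Qed.

Lemma fcons_lift T n (z : T) (w : 'I_n -> T) j : fcons z w (lift ord0 j) = w j.
Proof. by rewrite /fcons liftK. Qed.

Definition ffun_tail n (e : {ffun 'I_n.+1 -> int}) : {ffun 'I_n -> int} :=
  [ffun j => e (lift ord0 j)].

Lemma ffun_tail_eqN1 n (e : {ffun 'I_n.+1 -> int}) :
  (e == [ffun=> -1]) = (e ord0 == -1) && (ffun_tail e == [ffun=> -1]).
Proof.
apply/eqP/andP => [->|[/eqP e0 /eqP/ffunP et]].
  by split; apply/eqP; rewrite ?ffunE//; apply/ffunP => j; rewrite !ffunE.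
apply/ffunP => i; rewrite ffunE; case: (unliftP ord0 i) => [j|] ->//.
by have := et j; rewrite !ffunE.
Qed.

(** Induction from the outermost variable: the inner integral, as a function of the first variable,
    is again uniformly close to Laurent polynomials, with the error multiplied by [(4 * pi) ^+ n],
    so that [circle_int_approx] applies to it. *)
Lemma iter_circle_int_approx n (eps : 'I_n -> R) F :
  (forall i, 0 < eps i <= 1) ->
  (forall d, 0 < d -> exists s, laurent_approx eps d s F) ->
  forall d s, laurent_approx eps d s F ->
  `|iter_circle_int eps F - ((2 * pi)%:C * 'i%C) ^+ n * residue s| <=
    ((4 * pi) ^+ n * d)%:C.
Proof.
elim: n eps F => [|n IHn] eps F eps01 Fapp d s Fs.
  (* Without variables the only exponent vector is the empty one, which equals [[ffun=> -1]]; hence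
     [residue s] is the value of [laurent s]. *)
  rewrite expr0 mul1r mul1r /= (_ : residue s = laurent s (fun=> 0)).
    by apply: Fs => -[].
  rewrite /residue /laurent; apply: eq_big => [p|p _].
    by apply/eqP/ffunP => -[].
  by rewrite big_ord0 mulr1.
have pi40 m : 0 < (4 * pi) ^+ m :> R by rewrite exprn_gt0// mulr_gt0// pi_gt0.
(* [slice] freezes the first variable, moving its power into the coefficient; [head] keeps the
   monomials that survive the inner integration, as a Laurent polynomial in the first variable. *)
pose slice (s : seq (R[i] * {ffun 'I_n.+1 -> int})) z :=
  [seq (p.1 * z ^ p.2 ord0, ffun_tail p.2) | p : R[i] * {ffun 'I_n.+1 -> int} <- s].
pose head (s : seq (R[i] * {ffun 'I_n.+1 -> int})) :=
  [seq (((2 * pi)%:C * 'i%C) ^+ n * p.1, p.2 ord0)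
     | p : R[i] * {ffun 'I_n.+1 -> int} <- s & ffun_tail p.2 == [ffun=> -1]].
have sliceE t z w : laurent t (fcons z w) = laurent (slice t z) w.
  rewrite /laurent big_map; apply: eq_bigr => p _ /=.
  rewrite big_ord_recl fcons0 mulrA; congr (_ * _).
  by apply: eq_bigr => j _; rewrite fcons_lift ffunE.
have headE t z :
    ((2 * pi)%:C * 'i%C) ^+ n * residue (slice t z) = laurent1 (head t) z.
  rewrite /residue /laurent1 big_map [RHS]big_map big_filter mulr_sumr.
  by apply: eq_bigr => p _; rewrite mulrA.
have residueE t : ((2 * pi)%:C * 'i%C) ^+ n * residue t = residue1 (head t).
  rewrite /residue /residue1 big_map big_filter_cond mulr_sumr.
  by apply: eq_bigl => p; rewrite ffun_tail_eqN1 andbC.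
have sliceP e t z : laurent_approx eps e t F -> `|z| = (eps ord0)%:C ->
    laurent_approx (fun i => eps (lift ord0 i)) e (slice t z)
      (fun w => F (fcons z w)).
  move=> Ft z0 w wt; rewrite -sliceE; apply: Ft => k.
  by case: (unliftP ord0 k) => [j|] ->; rewrite ?fcons0 ?fcons_lift.
have headP e t : laurent_approx eps e t F ->
    forall z, `|z| = (eps ord0)%:C ->
    `|iter_circle_int (fun i => eps (lift ord0 i)) (fun w => F (fcons z w)) -
      laurent1 (head t) z| <= ((4 * pi) ^+ n * e)%:C.
  move=> Ft z z0; rewrite -headE; apply: IHn; last exact: sliceP.
    by move=> i; exact: eps01.
  by move=> e' /Fapp[t' Ft']; exists (slice t' z); exact: sliceP.
have -> : ((2 * pi)%:C * 'i%C) ^+ n.+1 * residue s =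
    (2 * pi)%:C * 'i%C * residue1 (head s) by rewrite exprS -residueE mulrA.
have -> : (4 * pi) ^+ n.+1 * d = 4 * pi * ((4 * pi) ^+ n * d).
  by rewrite exprS mulrA.
apply: circle_int_approx; [exact: eps01| |exact: headP].
(* The precision is divided by the factor that the inner integration introduces. *)
move=> e e0; have /Fapp[t Ft] : 0 < e / (4 * pi) ^+ n by rewrite divr_gt0.
exists (head t) => z /(headP _ _ Ft).
by rewrite mulrC divfK// gt_eqF.
Qed.

(** Approximations of every precision share the same coefficient [c], so no limit of coefficients
    has to be taken. *)
Definition has_residue n (eps : 'I_n -> R) (F : ('I_n -> R[i]) -> R[i]) (c : R[i]) :=
  forall d, 0 < d -> exists2 s, laurent_approx eps d s F & residue s = c.

Lemma iter_circle_int_residue n (eps : 'I_n -> R) F c :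
  (forall i, 0 < eps i <= 1) -> has_residue eps F c ->
  iter_circle_int eps F = ((2 * pi)%:C * 'i%C) ^+ n * c.
Proof.
move=> eps01 Fc; apply/eqP; rewrite -subr_eq0 -normr_le0.
have Fapp d : 0 < d -> exists s, laurent_approx eps d s F.
  by move=> /Fc[s Fs _]; exists s.
have pi40 : 0 < (4 * pi) ^+ n :> R by rewrite exprn_gt0// mulr_gt0// pi_gt0.
(* The modulus lies in [R[i]]; written as a real square root, it can be compared in [R] with every
   positive [d]. *)
rewrite normc_def lecR; apply/ler_addgt0Pl => d d0; rewrite addr0 -lecR -normc_def.
have /Fc[s Fs <-] : 0 < d / (4 * pi) ^+ n by rewrite divr_gt0.
have := iter_circle_int_approx eps01 Fapp Fs.
by rewrite [in leRHS]mulrC divfK// gt_eqF.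
Qed.

Lemma residue_cat n (s t : seq (R[i] * {ffun 'I_n -> int})) :
  residue (s ++ t) = residue s + residue t.
Proof. by rewrite /residue big_cat. Qed.

Lemma laurent_cat n (s t : seq (R[i] * {ffun 'I_n -> int})) z :
  laurent (s ++ t) z = laurent s z + laurent t z.
Proof. by rewrite /laurent big_cat. Qed.

Lemma has_residueB n (eps : 'I_n -> R) F G a b :
  has_residue eps F a -> has_residue eps G b ->
  has_residue eps (fun z => F z - G z) (a - b).
Proof.
move=> Fa Gb d d0; have d2 : 0 < d / 2 by rewrite divr_gt0.
have [s Fs <-] := Fa _ d2; have [t Gt <-] := Gb _ d2.
exists (s ++ [seq (- p.1, p.2) | p <- t]) => [z zt|].
  rewrite laurent_cat /laurent [X in _ - (_ + X)]big_map.
  under [X in _ - (_ + X)]eq_bigr do rewrite mulNr.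
  rewrite sumrN -!/(laurent _ _).
  rewrite (_ : _ - _ = (F z - laurent s z) - (G z - laurent t z)); last by ring.
  rewrite (le_trans (ler_normB _ _))// (splitr d) rmorphD lerD//.
  exact: Fs.
  exact: Gt.
by rewrite residue_cat /residue [X in _ + X]big_map sumrN.
Qed.

Lemma eq_has_residue n (eps : 'I_n -> R) F G a :
  (forall z, on_torus eps z -> F z = G z) ->
  has_residue eps F a -> has_residue eps G a.
Proof.
move=> FG Fa d /Fa[s Fs <-]; exists s => // z zt.
by rewrite -FG//; exact: Fs.
Qed.

Lemma has_residue_laurent n (eps : 'I_n -> R) s :
  has_residue eps (laurent s) (residue s).
Proof. by move=> d d0; exists s => // z _; rewrite subrr normr0 lecR ltW. Qed.

End IteratedIntegral.

(** * Degree in the first [r] variables *)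

Lemma norm_exprz (F : numFieldType) (x : F) (k : int) : `|x ^ k| = `|x| ^ k.
Proof. by case: k => m; rewrite ?NegzE -?exprnN ?normfV normrX. Qed.

Section Degree.
Variables (R : realType) (n : nat) (eps : 'I_n -> R) (r : nat).
Hypothesis eps_gt0 : forall i, 0 < eps i.
Implicit Types (F G : ('I_n -> R[i]) -> R[i]) (D E : int) (d : R).
Implicit Types (s : seq (R[i] * {ffun 'I_n -> int})).

Definition initial_degree (e : {ffun 'I_n -> int}) : int :=
  \sum_(i < n | (i < r)%N) e i.

(* [F] is a uniform limit of Laurent polynomials whose monomials all have degree
   at most [D] in the first [r] variables. *)
Definition approx_degree D F := forall d, 0 < d ->
  exists2 s, laurent_approx eps d s F & {in s, forall p, initial_degree p.2 <= D}.

Lemma on_torus_neq0 z : on_torus eps z -> forall k, z k != 0.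
Proof.
by move=> zt k; rewrite -normr_eq0 zt eq_complex /= eqxx andbT gt_eqF.
Qed.

Lemma approx_degree_le D E F : D <= E -> approx_degree D F -> approx_degree E F.
Proof.
move=> DE FD d /FD[s Fs sD]; exists s => // p /sD pD; exact: le_trans DE.
Qed.

Lemma eq_approx_degree D F G : (forall z, on_torus eps z -> F z = G z) ->
  approx_degree D F -> approx_degree D G.
Proof.
move=> FG FD d /FD[s Fs sD]; exists s => // z zt; rewrite -FG//; exact: Fs.
Qed.

(** This lets a convergent series be treated through its partial sums. *)
Lemma approx_degree_lim D F :
  (forall d, 0 < d -> exists2 G, approx_degree D G &
     forall z, on_torus eps z -> `|F z - G z| <= d%:C) -> approx_degree D F.
Proof.
move=> Flim d d0; have d2 : 0 < d / 2 by rewrite divr_gt0.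
have [G /(_ _ d2)[s Gs sD] FG] := Flim _ d2; exists s => // z zt.
rewrite -(subrK (G z) (F z)) -addrA (le_trans (ler_normD _ _))//.
by rewrite (splitr d) rmorphD lerD ?FG ?Gs.
Qed.

Lemma approx_degree_laurent D s : {in s, forall p, initial_degree p.2 <= D} ->
  approx_degree D (laurent s).
Proof.
by move=> sD d d0; exists s => // z _; rewrite subrr normr0 ler0c ltW.
Qed.

Lemma approx_degree0 D : approx_degree D (fun=> 0).
Proof.
apply: (@eq_approx_degree D (laurent [::])); last exact: approx_degree_laurent.
by move=> z _; rewrite /laurent big_nil.
Qed.

Lemma approx_degreeD D F G : approx_degree D F -> approx_degree D G ->
  approx_degree D (fun z => F z + G z).
Proof.
move=> FD GD d d0; have d2 : 0 < d / 2 by rewrite divr_gt0.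
have [s Fs sD] := FD _ d2; have [t Gt tD] := GD _ d2.
exists (s ++ t) => [z zt|p]; last first.
  by rewrite mem_cat => /orP[/sD|/tD].
rewrite laurent_cat opprD addrACA (le_trans (ler_normD _ _))//.
by rewrite (splitr d) rmorphD lerD ?Fs ?Gt.
Qed.

(** Each monomial has constant modulus on the torus, so the triangle inequality suffices. *)
Lemma laurent_bounded s : exists2 M : R, 0 < M &
  forall z, on_torus eps z -> `|laurent s z| <= M%:C.
Proof.
elim: s => [|p s [M M0 sM]].
  by exists 1 => // z _; rewrite /laurent big_nil normr0 lecE /= eqxx ler01.
have [A pA] : exists A : R, `|p.1| = A%:C by rewrite normc_def; eexists.
have A0 : 0 <= A by rewrite -ler0c -pA.
exists (A * \prod_k (eps k) ^ p.2 k + M).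
  by rewrite ltr_wpDl// mulr_ge0// prodr_ge0// => k _; rewrite exprz_ge0// ltW.
move=> z zt; rewrite /laurent big_cons -/(laurent _ _) rmorphD.
rewrite (le_trans (ler_normD _ _))// lerD ?sM// normrM rmorphM normr_prod.
rewrite rmorph_prod pA (eq_bigr (fun k => (eps k ^ p.2 k)%:C))// => k _.
by rewrite norm_exprz zt fmorphXz.
Qed.

(** If [s] and [t] approximate [F] and [G], then [F G - s t = F (G - t) + (F - s) t]. A bound of [F]
    fixes the precision of [t], and a bound of [t] then fixes that of [s]. *)
Lemma approx_degreeM D E F G : approx_degree D F -> approx_degree E G ->
  approx_degree (D + E) (fun z => F z * G z).
Proof.
move=> FD GE d d0.
have [M M0 FM] : exists2 M : R, 0 < M & forall z, on_torus eps z -> `|F z| <= M%:C.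
  have [s Fs _] := FD _ ltr01; have [M M0 sM] := laurent_bounded s.
  exists (1 + M); first by rewrite addr_gt0.
  move=> z zt; rewrite -(subrK (laurent s z) (F z)) (le_trans (ler_normD _ _))//.
  by rewrite rmorphD lerD ?sM//; exact: Fs.
have [t Gt tE] : exists2 t, laurent_approx eps (d / 2 / M) t G &
    {in t, forall p, initial_degree p.2 <= E}.
  by apply: GE; rewrite !divr_gt0.
have [N N0 tN] := laurent_bounded t.
have [s Fs sD] : exists2 s, laurent_approx eps (d / 2 / N) s F &
    {in s, forall p, initial_degree p.2 <= D}.
  by apply: FD; rewrite !divr_gt0.
pose mul (p q : R[i] * {ffun 'I_n -> int}) := (p.1 * q.1, p.2 + q.2).
exists [seq mul p q | p <- s, q <- t] => [z zt|]; last first.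
  move=> _ /allpairsP[[p q] [/sD pD /tE qE ->]] /=.
  rewrite (le_trans _ (lerD pD qE))// /initial_degree -big_split /=.
  by apply: ler_sum => i _; rewrite ffunE.
have -> : laurent [seq mul p q | p <- s, q <- t] z = laurent s z * laurent t z.
  rewrite /laurent big_allpairs_dep mulr_suml; apply: eq_bigr => p _.
  rewrite mulr_sumr; apply: eq_bigr => q _ /=.
  rewrite mulrACA -big_split /=; congr (_ * _); apply: eq_bigr => k _.
  by rewrite ffunE expfzDr// on_torus_neq0.
rewrite (_ : _ - _ = F z * (G z - laurent t z) + (F z - laurent s z) * laurent t z);
  last by ring.
rewrite (le_trans (ler_normD _ _))// !normrM (splitr d) rmorphD lerD//.
  rewrite -[leRHS](_ : (M * (d / 2 / M))%:C = _); last by congr _%:C; field; exact: lt0r_neq0.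
  by rewrite rmorphM ler_pM ?FM ?Gt.
rewrite -[leRHS](_ : (d / 2 / N * N)%:C = _); last by congr _%:C; field; exact: lt0r_neq0.
by rewrite rmorphM ler_pM ?tN ?Fs.
Qed.

Lemma approx_degree_monomial a (e : {ffun 'I_n -> int}) D :
  initial_degree e <= D -> approx_degree D (fun z => a * \prod_k z k ^ e k).
Proof.
move=> eD; apply: (@eq_approx_degree D (laurent [:: (a, e)])).
  by move=> z _; rewrite /laurent big_seq1.
by apply: approx_degree_laurent => p; rewrite inE => /eqP ->.
Qed.

Lemma approx_degree_cst a : approx_degree 0 (fun=> a).
Proof.
have aD : initial_degree 0 <= 0.
  by rewrite /initial_degree big1// => i _; rewrite ffunE.
apply: eq_approx_degree (approx_degree_monomial a aD) => z _.
by rewrite big1 ?mulr1// => k _; rewrite ffunE expr0z.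
Qed.

Lemma approx_degree_var (k : 'I_n) (m : int) :
  approx_degree (m * (k < r)%N) (fun z => z k ^ m).
Proof.
pose e := [ffun i => if i == k then m else 0].
have eD : initial_degree e <= m * (k < r)%N.
  rewrite /initial_degree; case: ltnP => kr.
    rewrite (bigD1 k)//= ffunE eqxx big1 ?addr0 ?mulr1// => i /andP[_ /negPf ik].
    by rewrite ffunE ik.
  rewrite big1 ?mulr0// => i ir; rewrite ffunE; case: eqP => // ik.
  by rewrite -ik leqNgt ir in kr.
apply: eq_approx_degree (approx_degree_monomial 1 eD) => z _.
rewrite mul1r (bigD1 k)//= ffunE eqxx big1 ?mulr1// => i /negPf ik.
by rewrite ffunE ik expr0z.
Qed.

Lemma approx_degree_prod (I : finType) (P : pred I) (D : I -> int)
    (F : I -> ('I_n -> R[i]) -> R[i]) :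
  (forall i, P i -> approx_degree (D i) (F i)) ->
  approx_degree (\sum_(i | P i) D i) (fun z => \prod_(i | P i) F i z).
Proof.
move=> FD; rewrite unlock.
elim: (index_enum I) => [|i l IHl] /=; first exact: approx_degree_cst.
by case: ifP => [/FD Di|//]; exact: approx_degreeM.
Qed.

Lemma approx_degreeX D F m : approx_degree D F ->
  approx_degree (D * m%:Z) (fun z => F z ^+ m).
Proof.
move=> FD; elim: m => [|m IHm].
  by rewrite mulr0; under eq_fun do rewrite expr0; exact: approx_degree_cst.
rewrite intS mulrDr mulr1; under eq_fun do rewrite exprS.
exact: approx_degreeM.
Qed.

(** The exponent vector [(-1, ..., -1)] has initial degree [-r], hence cannot occur in
    approximations of degree below [-r]. *)
Lemma has_residue0 D F : (r <= n)%N -> D < - r%:Z ->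
  approx_degree D F -> has_residue eps F 0.
Proof.
move=> rn Dr FD d /FD[s Fs sD]; exists s => //.
rewrite /residue big_seq_cond big_pred0// => p; apply/negP => /andP[/sD + /eqP pN1].
rewrite pN1 leNgt => /negP; apply; rewrite (lt_le_trans Dr)//.
rewrite /initial_degree (eq_bigr (fun=> -1)); last by move=> i _; rewrite ffunE.
rewrite (big_ord_narrow rn) sumr_const card_ord.
by rewrite mulNrn lerN2 natz.
Qed.

End Degree.

(** * Vanishing of the terms that violate a partial-sum inequality *)

Lemma Posz_sum (I : Type) (s : seq I) (P : pred I) (F : I -> nat) :
  (\sum_(i <- s | P i) F i)%N%:Z = \sum_(i <- s | P i) (F i)%:Z.
Proof. exact: (big_morph Posz PoszD (erefl _)). Qed.

Section VanishingTerms.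
Variables (R : realType) (n : nat) (eps : 'I_n -> R).
Hypothesis eps_gt0 : forall i, 0 < eps i.
Hypothesis eps_decr : forall i j : 'I_n, (i < j)%N -> eps j < eps i.

Lemma exists_expr_le (q d : R) : 0 <= q < 1 -> 0 < d -> exists N, q ^+ N <= d.
Proof.
move=> /andP[q0 q1] d0.
have /cvgrPdist_le/(_ _ d0)[N _ /(_ N (leqnn N))] : (q ^+ m @[m --> \oo] --> (0 : R))%classic.
  by apply: cvg_expr; rewrite ger0_norm.
by rewrite sub0r normrN ger0_norm ?exprn_ge0//; exists N.
Qed.

(** Remainder of the expansion of [1 / (x - y)] as a geometric series in [y / x]. *)
Lemma geometric_quotient (F : fieldType) (x y : F) N : x != 0 -> x - y != 0 ->
  (x - y)^-1 - \sum_(a < N) y ^+ a * x ^- a.+1 = (y / x) ^+ N * (x - y)^-1.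
Proof.
move=> x0 xy0; elim: N => [|N IHN]; first by rewrite big_ord0 subr0 expr0 mul1r.
rewrite big_ord_recr /= opprD addrA IHN !expr_div_n !exprS.
move: (y ^+ N) (x ^+ N) (expf_neq0 N x0) => u v v0.
by field; rewrite x0 v0 xy0.
Qed.

(** The geometric series has monomials [z_j^a z_k^(-a-1)]. As [k < j], the condition [j < r] forces
    [k < r], so the initial degree is at most [-1] if [k < r], and is [0] otherwise. *)
Lemma approx_degree_inv_sub_lt (r : nat) (k j : 'I_n) : (k < j)%N ->
  approx_degree eps r (- (k < r)%N%:Z) (fun z => (z k - z j)^-1).
Proof.
move=> kj; have ekj := eps_decr kj; apply: approx_degree_lim => d d0.
have e0 : 0 < eps k - eps j by rewrite subr_gt0.
(* On the torus the remainder after [N] terms is at most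
   [(eps j / eps k) ^+ N / (eps k - eps j)]. *)
have [N qN] : exists N, (eps j / eps k) ^+ N <= d * (eps k - eps j).
  apply: exists_expr_le; last by rewrite mulr_gt0.
  by rewrite divr_ge0 ?ltW// ltr_pdivrMr// mul1r.
exists (fun z => \sum_(a < N) z j ^+ a * z k ^- a.+1).
  rewrite unlock; elim: (index_enum _) => [|a l IHl] /=.
    exact: approx_degree0.
  apply: approx_degreeD => //.
  apply: (approx_degree_le _ (approx_degreeM _
     (approx_degree_var _ r j a%:Z) (approx_degree_var _ r k (- a.+1%:Z)))) => //.
  by case: (ltnP k r); case: (ltnP j r) => /=; lia.
move=> z zt; have zk0 : z k != 0 by rewrite (on_torus_neq0 _ zt).
have zkj : (eps k - eps j)%:C <= `|z k - z j|.
  by rewrite (le_trans _ (lerB_dist _ _))// !zt rmorphB.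
have zkj0 : 0 < `|z k - z j| by rewrite (lt_le_trans _ zkj)// ltcR.
rewrite geometric_quotient//; last by rewrite -normr_gt0.
rewrite normrM normrX normfV !normf_div !zt ler_pdivrMr//.
rewrite -fmorphV -rmorphM -rmorphXn /=.
rewrite (@le_trans _ _ (d * (eps k - eps j))%:C) ?lecR//.
by rewrite rmorphM ler_wpM2l// ler0c ltW.
Qed.

(** The smaller index governs the expansion, and it is below [r] exactly when one of the two is. *)
Lemma approx_degree_inv_sub (r : nat) (k j : 'I_n) : j != k ->
  approx_degree eps r (- ((k < r) || (j < r))%N%:Z) (fun z => (z k - z j)^-1).
Proof.
rewrite -val_eqE neq_ltn /= => /orP[jk|kj].
  apply: (@eq_approx_degree _ _ _ _ _ (fun z => -1 * (z j - z k)^-1)).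
    by move=> z _; rewrite mulN1r -invrN opprB.
  apply: (approx_degree_le _ (approx_degreeM _ (approx_degree_cst _ r (-1))
    (approx_degree_inv_sub_lt r jk))) => //.
  by case: (ltnP k r); case: (ltnP j r) => /=; lia.
apply: (approx_degree_le _ (approx_degree_inv_sub_lt r kj)) => //.
by case: (ltnP k r); case: (ltnP j r) => /=; lia.
Qed.

(** A degree count. With [S] the sum of the first [r] entries of [m] and [S' = n - S] that of the
    others, the initial degree is at most [-(t+1) r + t S - r S']. As [S <= r] and
    [S' >= n - r > 0], this is below [-r]. *)
Lemma has_residue_term0 (t r : nat) (a : R[i]) (m : 'I_n -> nat) :
  (0 < r < n)%N -> (\sum_i m i = n)%N ->
  (\sum_(i < n | (i < r)%N) m i <= r)%N ->
  has_residue eps (fun z => (\prod_k z k) ^- (t + 1) * (a *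
    \prod_k (z k ^+ (t + n - 1) / \prod_(j | j != k) (z k - z j)) ^+ m k)) 0.
Proof.
move=> /andP[r0 rn] mn mr.
pose D (k : 'I_n) : int := (t + n - 1)%:Z * (k < r)%N -
   \sum_(j < n | j != k) ((k < r) || (j < r))%N%:Z.
have FD : approx_degree eps r (\sum_(k < n) (- (t + 1)%:Z) * (k < r)%N +
     (0 + \sum_k D k * (m k)%:Z))
  (fun z => (\prod_k z k ^ (- (t + 1)%:Z)) * (a *
    \prod_k (z k ^ (t + n - 1)%:Z * \prod_(j | j != k) (z k - z j)^-1) ^+ m k)).
  apply: approx_degreeM => //.
    by apply: approx_degree_prod => // k _; exact: approx_degree_var.
  apply: approx_degreeM => //; first exact: approx_degree_cst.
  apply: approx_degree_prod => // k _; apply: approx_degreeX => //.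
  apply: approx_degreeM => //; first exact: approx_degree_var.
  rewrite -sumrN; apply: approx_degree_prod => // j jk.
  exact: approx_degree_inv_sub.
apply: (has_residue0 (r := r)) (ltnW rn) _ _; last first.
  apply: eq_approx_degree FD => z zt.
  rewrite -prodrXl -prodfV; congr (_ * (_ * _)).
    by apply: eq_bigr => k _; rewrite -exprnN.
  by apply: eq_bigr => k _; rewrite prodfV.
have sumI : \sum_(k < n) ((k < r)%N : nat) = r.
  rewrite -big_mkcond (big_ord_narrow (ltnW rn)) sum1_card card_ord //.
(* For [k < r] all [n - 1] differences count, leaving [t + n - 1 - (n - 1)]. For [k >= r] only the
   [r] differences with [j < r] count, and the power of [z k] does not. *)
have DE k : D k = if (k < r)%N then t%:Z else - r%:Z.
  have -> : D k = (t + n - 1)%:Z * (k < r)%N -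
      (\sum_(j < n | j != k) ((k < r) || (j < r)) : nat)%:Z.
    by rewrite /D Posz_sum.
  case: ltnP => kr /=.
    by rewrite sum_nat_const muln1 cardC1 card_ord; lia.
  suff -> : (\sum_(j < n | j != k) (j < r) = r)%N by lia.
  by rewrite -[RHS]sumI [RHS](bigD1 k)//= ltnNge kr.
rewrite -mulr_sumr add0r.
rewrite (_ : \sum_(k < n) _ = r%:Z); last first.
  by rewrite -[in RHS]sumI Posz_sum.
rewrite (_ : \sum_k _ = t%:Z * (\sum_(i < n | (i < r)%N) m i)%N -
    r%:Z * (\sum_(i < n | ~~ (i < r)%N) m i)%N); last first.
  rewrite (bigID (fun k : 'I_n => (k < r)%N)) /= !Posz_sum !mulr_sumr.
  rewrite -sumrN; congr (_ + _); apply: eq_bigr => k kr.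
    by rewrite DE kr.
  by rewrite DE (negPf kr) mulNr.
move: mn; rewrite (bigID (fun k : 'I_n => (k < r)%N)) /=.
move: mr; set S := (\sum_(i < n | (i < r)) m i)%N.
set S' := (\sum_(i < n | ~~ (i < r)) m i)%N => Sr Sn.
have : (0 < S')%N by lia.
by nia.
Qed.

End VanishingTerms.

(** * Identities for symmetric functions *)

Section SymmetricFunctions.

(* Generating functions truncated at degree [T]: sums over exponent vectors
   become coefficients, which can be computed by induction on the number of
   variables. *)
Lemma coef_prod_poly (F : comNzRingType) n T (g : 'I_n -> nat -> F) s :
  (\prod_i \poly_(a < T.+1) g i a)`_s =
  \sum_(f : {ffun 'I_n -> 'I_T.+1} | (\sum_i f i == s)%N) \prod_i g i (f i).
Proof.
under eq_bigr do rewrite poly_def.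
rewrite bigA_distr_bigA coef_sum [RHS]big_mkcond; apply: eq_bigr => f _ /=.
rewrite scaler_prod prodrXr coefZ coefXn eq_sym.
by case: eqP; rewrite ?mulr1 ?mulr0.
Qed.

(** Lagrange interpolation: the difference of the two sides is a polynomial in [x] of degree at most
    [n] with the [n + 1] distinct roots [y k]. *)
Lemma lagrange_exprn (F : fieldType) n (y : 'I_n.+1 -> F) x : injective y ->
  x ^+ n = \sum_k y k ^+ n / \prod_(j | j != k) (y k - y j) *
                  \prod_(j | j != k) (x - y j).
Proof.
move=> y_inj; pose c k := y k ^+ n / \prod_(j | j != k) (y k - y j).
pose p : {poly F} := 'X^n - \sum_k c k *: \prod_(j | j != k) ('X - (y j)%:P).
have pE u : p.[u] = u ^+ n - \sum_k c k * \prod_(j | j != k) (u - y j).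
  rewrite /p !hornerE horner_sum; congr (_ - _); apply: eq_bigr => k _.
  by rewrite hornerZ horner_prod; under eq_bigr do rewrite !hornerE.
suff p0 : p = 0 by apply/eqP; rewrite -subr_eq0 -pE p0 horner0.
apply/eqP; apply: contraT => pn0.
have := max_poly_roots pn0 (_ : all (root p) [seq y i | i <- enum 'I_n.+1]).
rewrite map_inj_uniq ?enum_uniq// size_map size_enum_ord.
suff sp : (size p <= n.+1)%N.
  rewrite ltnNge sp => H; apply: H => //.
  apply/allP => _ /mapP[i _ ->]; rewrite /root pE (bigD1 i)//=.
  rewrite [X in _ - (_ + X)]big1 => [|k ki]; last first.
    by rewrite (bigD1 i) 1?eq_sym//= subrr mul0r mulr0.
  rewrite addr0 /c divfK ?subrr//; apply/prodf_neq0 => j ji.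
  by rewrite subr_eq0; apply: contraNneq ji => /y_inj ->.
rewrite (leq_trans (size_polyD _ _))// geq_max size_polyXn leqnn/= size_polyN.
rewrite (leq_trans (size_sum _ _ _))//; apply/bigmax_leqP => k _.
rewrite (leq_trans (size_scale_leq _ _))//.
by rewrite -big_filter size_prod_XsubC -sum1_size big_filter sum1_card cardC1 card_ord.
Qed.

Lemma prod_neq_lift0 (F : comNzRingType) n (G : 'I_n.+1 -> F) (k : 'I_n) :
  \prod_(j | j != lift ord0 k) G j = G ord0 * \prod_(j | j != k) G (lift ord0 j).
Proof.
rewrite big_mkcond big_ord_recl /= [in RHS]big_mkcond; congr (_ * _).
Qed.

(** The left side is the complete homogeneous symmetric polynomial [h_s], which truncation at
    [T >= s] leaves intact. Induction on the number of variables uses [h_s(z) = sum_j z_0^j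
    h_(s-j)(z_1, z_2, ...)]. *)
Lemma complete_homogeneous_sum (F : fieldType) n T s (z : 'I_n.+1 -> F) :
  injective z -> (s <= T)%N ->
  (\prod_i \poly_(a < T.+1) z i ^+ a)`_s =
  \sum_k z k ^+ (s + n) / \prod_(j | j != k) (z k - z j).
Proof.
elim: n s z => [|n IHn] s z z_inj sT.
  rewrite !big_ord1 coef_poly ltnS sT addn0 big_pred0 ?divr1// => j.
  by rewrite ord1 eqxx.
pose y k := z (lift ord0 k).
have y_inj : injective y by move=> i j /z_inj/lift_inj.
pose P k := \prod_(j | j != k) (y k - y j).
have zy k : z ord0 - y k != 0.
  by rewrite subr_eq0; apply/eqP => /z_inj/eqP; rewrite (negPf (neq_lift _ _)).
have P0 k : P k != 0.
  apply/prodf_neq0 => j jk.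
  by rewrite subr_eq0; apply: contraNneq jk => /y_inj ->.
rewrite big_ord_recl coefM /=.
transitivity (\sum_(j < s.+1) z ord0 ^+ j * \sum_k y k ^+ (s - j + n) / P k).
  apply: eq_bigr => -[j /=]; rewrite ltnS => js _.
  by rewrite coef_poly ltnS (leq_trans js)// IHn// (leq_trans _ sT) ?leq_subr.
(* The sum over [j] is geometric, with value [(y_k^(s+1) - z_0^(s+1)) / (y_k - z_0)]. *)
transitivity (\sum_k ((y k ^+ (s + n.+1)) / (P k * (y k - z ord0)) -
   z ord0 ^+ s.+1 * (y k ^+ n / (P k * (y k - z ord0))))).
  under eq_bigr do rewrite mulr_sumr.
  rewrite exchange_big /=; apply: eq_bigr => k _.
  have -> : \sum_(j < s.+1) z ord0 ^+ j * (y k ^+ (s - j + n) / P k) =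
      y k ^+ n / P k * \sum_(j < s.+1) y k ^+ (s.+1.-1 - j) * z ord0 ^+ j.
    rewrite mulr_sumr; apply: eq_bigr => j _; rewrite exprD /=; ring.
  have yz : y k - z ord0 != 0 by rewrite -opprB oppr_eq0.
  apply: (mulIf yz); rewrite -[LHS]mulrA [X in _ * X]mulrC -subrXX.
  rewrite addnS -addSn exprD.
  field.
  by rewrite P0 yz.
(* The first parts are the summands of index [k > 0] on the right; the second parts combine into the
   summand of index 0 by Lagrange interpolation at [z ord0]. *)
rewrite [RHS]big_ord_recl sumrB -mulr_sumr addrC; congr (_ + _); last first.
  apply: eq_bigr => k _; congr (_ / _).
  by rewrite prod_neq_lift0 mulrC.
rewrite -mulrN -sumrN addnS -addSn exprD -mulrA; congr (_ * _).
rewrite (lagrange_exprn (z ord0) y_inj) mulr_suml; apply: eq_bigr => k _.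
have -> : \prod_(j | j != ord0) (z ord0 - z j) = \prod_k (z ord0 - y k).
  by rewrite big_mkcond big_ord_recl /= mul1r.
rewrite -/(P k) [X in _ = _ / X](bigD1 k)//=.
have Q0 : \prod_(j | j != k) (z ord0 - y j) != 0 by apply/prodf_neq0.
have yz : y k - z ord0 != 0 by rewrite -opprB oppr_eq0.
by field; rewrite Q0 zy P0 yz.
Qed.

(** Exponential generating functions: up to degree [T], the truncated series of the [exp(x_k X)]
    multiply to that of [exp((sum_k x_k) X)]. *)
Lemma multinomial_theorem (F : numFieldType) n T (x : 'I_n -> F) :
  (\sum_k x k) ^+ T =
  \sum_(m : {ffun 'I_n -> 'I_T.+1} | (\sum_i m i == T)%N)
     T`!%:R / (\prod_i (m i)`!%:R) * \prod_k x k ^+ m k.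
Proof.
have fact0 i : i`!%:R != 0 :> F by rewrite pnatr_eq0 -lt0n fact_gt0.
(* All degrees up to [T] are covered, because splitting off one variable by the binomial theorem
   involves the lower ones. *)
suff coefE s : (s <= T)%N ->
    (\prod_k \poly_(a < T.+1) (x k ^+ a / a`!%:R))`_s =
    (\sum_k x k) ^+ s / s`!%:R.
  have := coefE T (leqnn _); rewrite coef_prod_poly => /esym/(canRL (divfK (fact0 T))) ->.
  rewrite mulr_suml; apply: eq_bigr => m _.
  by rewrite big_split /= prodfV; ring.
elim: n x s => [|n IHn] x s sT.
  rewrite !big_ord0 coef1 expr0n; case: s sT => [|s] _ /=.
    by rewrite divr1.
  by rewrite mul0r.
rewrite !big_ord_recl coefM /= addrC exprDn mulr_suml.
apply: eq_bigr => -[j /=]; rewrite ltnS => js _.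
rewrite coef_poly ltnS (leq_trans js)// IHn; last by rewrite (leq_trans _ sT) ?leq_subr.
rewrite -mulr_natr -(bin_fact js) !natrM.
have b0 : 'C(s, j)%:R != 0 :> F by rewrite pnatr_eq0 -lt0n bin_gt0.
by field; rewrite b0 !fact0.
Qed.

End SymmetricFunctions.

(** * Lattice points of the dilated polytope as integer matrices *)

Section Ehrhart.

(** Matrices are families of rows, the form in which a power of a sum over rows expands. Bounding
    the entries by [t] loses nothing, as they are naturals in rows of sum [t]. *)
Definition row_sums (n t : nat) : {set {ffun 'I_n -> {ffun 'I_n -> 'I_t.+1}}} :=
  [set A : {ffun 'I_n -> {ffun 'I_n -> 'I_t.+1}} |
    [forall j, (\sum_k A j k == t)%N]]%SET.

Definition col_sums (n t : nat) : {set {ffun 'I_n -> {ffun 'I_n -> 'I_t.+1}}} :=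
  [set A : {ffun 'I_n -> {ffun 'I_n -> 'I_t.+1}} |
    [forall k, (\sum_j A j k == t)%N]]%SET.

Lemma ehrhart_card (R : realType) n t :
  ehrhart R n t = #|row_sums n t :&: col_sums n t|.
Proof.
pose f (A : {ffun 'I_n -> {ffun 'I_n -> 'I_t.+1}}) : 'M[R]_n :=
  \matrix_(j, k) (A j k)%:R.
have f_inj : injective f.
  move=> A B /matrixP AB; apply/ffunP => j; apply/ffunP => k; apply/val_inj.
  by have := AB j k; rewrite !mxE => /eqP; rewrite eqr_nat => /eqP.
have -> : ehrhart R n t = #|` [fset f A | A in row_sums n t :&: col_sums n t]|%fset.
  rewrite /ehrhart; congr #|` _|%fset; apply/fsetP => X.
  rewrite in_fset_set; last exact: finite_birkhoff_lattice.
  apply/idP/imfsetP => /= [|[A]].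
    rewrite inE => -[[Y [Y0 Yr Yc] <-] Xint].
    have Yle j k : Y j k <= 1 by rewrite -(Yr j) (bigD1 k)//= lerDl sumr_ge0.
    pose A : {ffun 'I_n -> {ffun 'I_n -> 'I_t.+1}} :=
      [ffun j => [ffun k => inord (Num.truncn (t%:R * Y j k))]].
    have AE j k : (A j k)%:R = t%:R * Y j k.
      have tY0 : 0 <= t%:R * Y j k by rewrite mulr_ge0.
      have tYnat : t%:R * Y j k \in Num.nat.
        by rewrite natrEint tY0 andbT; have := Xint j k; rewrite mxE.
      by rewrite !ffunE inordK ?truncnK// ltnS -(ler_nat R) truncnK// ler_piMr.
    exists A; last by apply/matrixP => j k; rewrite !mxE AE.
    rewrite !inE; apply/andP; split; apply/forallP => j; rewrite -(eqr_nat R) natr_sum.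
      by under eq_bigr do rewrite AE; rewrite -mulr_sumr Yr mulr1.
    by under eq_bigr do rewrite AE; rewrite -mulr_sumr Yc mulr1.
  rewrite !inE => /andP[/forallP Ar /forallP Ac] ->; split; last first.
    by move=> j k; rewrite mxE.
  (* For [t = 0] one cannot divide by [t]; then [A] is zero, and the identity matrix serves as a
     point of the polytope to be scaled. *)
  have [t0|t0] := posnP t.
    exists 1%:M.
      split=> [j k|j|k]; first by rewrite mxE ler0n.
        rewrite (bigD1 j)//= big1 ?addr0 ?mxE ?eqxx// => k /negPf kj.
        by rewrite mxE eq_sym kj.
      rewrite (bigD1 k)//= big1 ?addr0 ?mxE ?eqxx// => j /negPf kj.
      by rewrite mxE kj.
    apply/matrixP => j k; rewrite !mxE.
    have -> : A j k = 0%N :> nat by have := ltn_ord (A j k); lia.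
    by rewrite t0 mul0r.
  have tR0 : t%:R != 0 :> R by rewrite pnatr_eq0 -lt0n.
  exists (t%:R^-1 *: f A); last by rewrite scalerA divff// scale1r.
  split=> [j k|j|k]; first by rewrite !mxE mulr_ge0// invr_ge0.
    under eq_bigr do rewrite !mxE.
    by rewrite -mulr_sumr -natr_sum (eqP (Ar j)) mulVf.
  under eq_bigr do rewrite !mxE.
  by rewrite -mulr_sumr -natr_sum (eqP (Ac k)) mulVf.
by rewrite card_imfset//= -cardE.
Qed.

End Ehrhart.

(** * Residue of the sum over all tuples, and the final formula *)

Section ResidueOfTotal.
Variables (R : realType) (n : nat) (eps : 'I_n -> R).
Hypothesis eps_gt0 : forall i, 0 < eps i.
Hypothesis eps_decr : forall i j : 'I_n, (i < j)%N -> eps j < eps i.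

Lemma on_torus_inj z : on_torus eps z -> injective z.
Proof.
move=> zt i j zij; have : eps i = eps j by apply: complexI; rewrite -!zt zij.
apply: contra_eq; rewrite -val_eqE neq_ltn => /orP[] /eps_decr.
  by move/gt_eqF/negbT.
by move/lt_eqF/negbT.
Qed.

(** Expanding the power picks a monomial of degree [t] for each row; the exponent of [z k] in the
    product is the sum of column [k]. *)
Lemma homogeneous_sum_expr (F : comNzRingType) t (z : 'I_n -> F) :
  (\sum_(f : {ffun 'I_n -> 'I_t.+1} | (\sum_i f i == t)%N) \prod_i z i ^+ f i) ^+ n =
  \sum_(A in row_sums n t) \prod_k z k ^+ (\sum_j A j k)%N.
Proof.
rewrite -[X in _ ^+ X]card_ord -prodr_const bigA_distr_big /=.
apply: eq_big => A; rewrite ?inE.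
  by apply/ffun_onP/forallP.
by move=> _; rewrite exchange_big; apply: eq_bigr => k _; rewrite prodrXr.
Qed.

(** On the torus the [z k] are distinct, and the function coincides with the Laurent polynomial
    [(z_1 ... z_n)^(-t-1) h_t(z)^n], so the approximation is exact. *)
Lemma has_residue_total t : (0 < n)%N ->
  has_residue eps (fun z => (\prod_k z k) ^- (t + 1) *
    (\sum_k z k ^+ (t + n - 1) / \prod_(j | j != k) (z k - z j)) ^+ n)
    (ehrhart R n t)%:R.
Proof.
move=> n0.
(* An exponent is [-1] exactly when its column sum is [t], so the residue selects the matrices that
   also lie in [col_sums n t]. *)
pose e (A : {ffun 'I_n -> {ffun 'I_n -> 'I_t.+1}}) : {ffun 'I_n -> int} :=
  [ffun k => (\sum_j A j k)%N%:Z - (t + 1)%N%:Z].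
pose s : seq (R[i] * {ffun 'I_n -> int}) := [seq (1, e A) | A in row_sums n t].
have -> : (ehrhart R n t)%:R = residue s.
  rewrite /residue big_map big_enum_cond /= sumr_const ehrhart_card -mulr_natr mul1r.
  congr _%:R; apply: eq_card => A; rewrite !inE; congr (_ && _); first by rewrite inE.
  apply/forallP/eqP => [Ac|/ffunP Ac k].
    by apply/ffunP => k; rewrite !ffunE (eqP (Ac k)) PoszD opprD addrA subrr.
  by have := Ac k; rewrite !ffunE PoszD => ?; apply/eqP; lia.
apply: eq_has_residue (has_residue_laurent _ s) => z zt.
have zinj := on_torus_inj zt.
have -> : \sum_k z k ^+ (t + n - 1) / \prod_(j | j != k) (z k - z j) =
    \sum_(f : {ffun 'I_n -> 'I_t.+1} | (\sum_i f i == t)%N) \prod_i z i ^+ f i.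
  rewrite -(@coef_prod_poly _ _ _ (fun i a => z i ^+ a)).
  have -> : (t + n - 1)%N = (t + n.-1)%N by lia.
  case: (n) n0 z zinj {zt} => // n' _ z zinj.
  by rewrite complete_homogeneous_sum.
rewrite homogeneous_sum_expr /laurent big_map big_enum /= mulr_sumr.
apply: eq_bigr => A _; rewrite mul1r -prodrXl -prodfV -big_split /=.
apply: eq_bigr => k _; rewrite ffunE expfzDr ?(on_torus_neq0 eps_gt0 zt)//.
by rewrite mulrC exprnN.
Qed.

Lemma has_residueB_sum (I : Type) (l : seq I) (P : pred I)
    (F : ('I_n -> R[i]) -> R[i]) (G : I -> ('I_n -> R[i]) -> R[i]) c :
  has_residue eps F c -> (forall i, P i -> has_residue eps (G i) 0) ->
  has_residue eps (fun z => F z - \sum_(i <- l | P i) G i z) c.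
Proof.
move=> Fc G0; elim: l => [|i l IHl].
  by apply: eq_has_residue Fc => z _; rewrite big_nil subr0.
have [Pi|nPi] := boolP (P i); last first.
  by apply: eq_has_residue IHl => z _; rewrite big_cons (negPf nPi).
rewrite -(subr0 c); apply: eq_has_residue (has_residueB IHl (G0 _ Pi)) => z _.
by rewrite big_cons Pi opprD addrAC addrA.
Qed.

End ResidueOfTotal.

Theorem corollary4 (R : realType) (n t : nat) (eps : 'I_n -> R)
    (n_gt0 : (0 < n)%N)
    (eps_bounds : forall i : 'I_n, 0 < eps i < 1)
    (eps_decr : forall i j : 'I_n, (i < j)%N -> eps j < eps i) :
  (ehrhart R n t)%:R =
  ((2 * pi)%:C * 'i%C) ^- n *
  iter_circle_int eps (fun z : 'I_n -> R[i] =>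
    (\prod_k z k) ^- (t + 1) *
    \sum_(m in Mset n)
       multinomial R[i] (fun k => m k : nat) *
       \prod_k (z k ^+ (t + n - 1) / \prod_(j | j != k) (z k - z j)) ^+ m k)
  :> R[i].
Proof.
have eps_gt0 i : 0 < eps i by case/andP: (eps_bounds i).
have eps01 i : 0 < eps i <= 1 by case/andP: (eps_bounds i) => -> /ltW ->.
have pi0 : (2 * pi)%:C * 'i%C != 0 :> R[i].
  rewrite mulf_neq0//; first by rewrite eq_complex /= eqxx andbT gt_eqF// pi2_gt0.
  by rewrite eq_complex /= oner_eq0 andbF.
rewrite (@iter_circle_int_residue _ _ _ _ (ehrhart R n t)%:R)//.
  by rewrite mulKf// expf_neq0.
pose x (z : 'I_n -> R[i]) k := z k ^+ (t + n - 1) / \prod_(j | j != k) (z k - z j).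
pose term (m : {ffun 'I_n -> 'I_n.+1}) (z : 'I_n -> R[i]) := (\prod_k z k) ^- (t + 1) *
  (multinomial R[i] (fun k => m k : nat) * \prod_k x z k ^+ m k).
(* A tuple of total [n] outside [Mset n] violates the inequality at some [r] with [0 < r < n], as
   [has_residue_term0] demands. *)
pose bad (m : {ffun 'I_n -> 'I_n.+1}) := (\sum_i m i == n)%N && (m \notin Mset n).
have term0 m : bad m -> has_residue eps (term m) 0.
  rewrite /bad inE => /andP[/eqP mn]; rewrite mn eqxx /= => /forallPn[r].
  rewrite negb_imply -leqNgt => /andP[r0 mr].
  by apply: has_residue_term0 mr => //; rewrite r0 ltn_ord.
(* Removing the bad terms from the full multinomial expansion keeps the residue and leaves exactly
   the sum over [Mset n]. *)
apply: eq_has_residue (has_residueB_sum (index_enum _)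
  (has_residue_total eps_gt0 eps_decr t n_gt0) term0) => z _.
rewrite -/(x z _) multinomial_theorem -mulr_sumr -mulrBr; congr (_ * _).
rewrite (bigID (mem (Mset n))) /= addrK; apply: eq_bigl => m.
by rewrite andb_idl// inE => /andP[].
Qed.
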